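(* Let $\mathcal{S}$ be a Shuffler strategy and $\mathcal{S}_g$ the greedy strategy. Then $\mathcal{S}$ is a minimizing Shuffler strategy if and only if $\mathcal{S}(d)$ has the same distribution as $\mathcal{S}_g(d)$ for all nonzero $n$-vectors $d$ (of any length $n$), and $\mathcal{S}$ is a maximizing Shuffler strategy if and only if $\mathcal{S}(d)$ has the same distribution as $\mathcal{S}_g(d)$ for all fully-supported $n$-vectors $d$ (of any length $n$).
   Context: For an integer $n\ge 1$, an $n$-vector is a vector $d=(d_1,\ldots,d_n)$ of non-negative integers ($d_i$ is the number of cards of type $i$ left in the deck), and $[n]=\{1,\dots,n\}$. Let $\mathrm{supp}(d)=\{i: d_i>0\}$, and let $\delta_i$ be the $n$-vector with a 1 in position $i$ and 0's elsewhere. An $n$-vector $d$ is fully-supported if $\mathrm{supp}(d)=[n]$. A Guesser strategy $\mathcal{G}$ is a function assigning to each nonzero $n$-vector $d$ (for all $n$) a random variable $\mathcal{G}(d)$ with support in $[n]$. A Shuffler strategy $\mathcal{S}$ is a function assigning to each nonzero $n$-vector $d$ (for all $n$) a random variable $\mathcal{S}(d)$ with support in $\mathrm{supp}(d)$. Strategies matter only through the distributions of these random variables. In the game, the players choose simultaneously: in each round the choices of the two players are independent of each other, and (given the current deck) of all earlier rounds. The score is defined recursively by $C(d,\mathcal{G},\mathcal{S})=0$ if $d=(0,\ldots,0)$, and otherwise $C(d,\mathcal{G},\mathcal{S})=1_{\mathcal{S}(d)=\mathcal{G}(d)}+C(d-\delta_{\mathcal{S}(d)},\mathcal{G},\mathcal{S})$.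 Define \[f(d,\mathcal{S})=\max_{\mathcal{G}}\mathbb{E}[C(d,\mathcal{G},\mathcal{S})],\quad f(d)=\min_{\mathcal{S}}f(d,\mathcal{S}),\quad F(d,\mathcal{S})=\min_{\mathcal{G}}\mathbb{E}[C(d,\mathcal{G},\mathcal{S})],\quad F(d)=\max_{\mathcal{S}}F(d,\mathcal{S}),\] the maxima and minima being over all Guesser or Shuffler strategies as appropriate. $\mathcal{S}$ is a minimizing Shuffler strategy if $f(d,\mathcal{S})=f(d)$ for all $n$-vectors $d$ of any length $n$, and a maximizing Shuffler strategy if $F(d,\mathcal{S})=F(d)$ for all $n$-vectors $d$ of any length $n$. The greedy strategy $\mathcal{S}_g$ is the Shuffler strategy with $\Pr[\mathcal{S}_g(d)=i]=|\mathrm{supp}(d)|^{-1}$ for all $i\in\mathrm{supp}(d)$. *)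

(* Defs.v *)
From mathcomp Require Import all_boot all_order all_algebra.
From mathcomp Require Import boolp classical_sets reals.

Set Implicit Arguments.
Unset Strict Implicit.
Unset Printing Implicit Defensive.

Import Order.TTheory GRing.Theory Num.Theory.
Local Open Scope classical_set_scope.
Local Open Scope ring_scope.

(* Card types are indexed by 'I_n = {0, ..., n - 1}; the zero vector is the 0
   of the pointwise additive structure on {ffun 'I_n -> nat}. *)
Definition deck (n : nat) := {ffun 'I_n -> nat}.

Section Decks.
Variable n : nat.
Implicit Types (d : deck n) (i : 'I_n).

Definition supp d : {set 'I_n} := [set i | (0 < d i)%N]%SET.

Definition fully_supported d : bool := supp d == [set: 'I_n]%SET.

Definition delta i : deck n := [ffun j => (j == i : nat)].

(* d - delta_i; the subtraction is truncated, hence exact when i \in supp d. *)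
Definition remove d i : deck n := [ffun j => (d j - delta i j)%N].

Definition deck_size d : nat := (\sum_i d i)%N.

(* A play lists, round by round, the pair (Shuffler's card, Guesser's guess). *)
Fixpoint score d (w : seq ('I_n * 'I_n)) : nat :=
  if d == 0 then 0%N else
  if w is (s, g) :: w' then ((s == g) + score (remove d s) w')%N else 0%N.

End Decks.

Definition is_distribution (R : realType) n (p : 'I_n -> R) : Prop :=
  (forall i, 0 <= p i) /\ \sum_i p i = 1.

(* A strategy is given by the laws of its random choices. The value at d = 0
   is unconstrained; it does not affect the play probabilities below. *)
Record guesser (R : realType) := Guesser {
  guess_pr : forall n, deck n -> 'I_n -> R;
  guess_distribution :
    forall n (d : deck n), d != 0 -> is_distribution (guess_pr d) }.

Record shuffler (R : realType) := Shuffler {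
  shuffle_pr : forall n, deck n -> 'I_n -> R;
  shuffle_distribution :
    forall n (d : deck n), d != 0 -> is_distribution (shuffle_pr d);
  shuffle_supp :
    forall n (d : deck n) i, d != 0 -> i \notin supp d -> shuffle_pr d i = 0 }.

Section Game.
Variable R : realType.
Implicit Types (G : guesser R) (S : shuffler R).

(* In each round the two choices are independent of each other and, given the
   current deck, of the past: the probability of a play is a product. *)
Fixpoint play_pr n (d : deck n) G S (w : seq ('I_n * 'I_n)) : R :=
  if w is (s, g) :: w' then
    shuffle_pr S d s * guess_pr G d g * play_pr (remove d s) G S w'
  else 1.

(* E[C(d, G, S)]: the game lasts exactly deck_size d rounds. *)
Definition expected_score n (d : deck n) G S : R :=
  \sum_(w : (deck_size d).-tuple ('I_n * 'I_n))
    play_pr d G S w * (score d w)%:R.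

(* The greatest (least) element of A; the default 0 is used only when A has
   none. *)
Definition max_of (A : set R) : R := xget 0 (A `&` ubound A).
Definition min_of (A : set R) : R := xget 0 (A `&` lbound A).

(* The next four are the quantities f(d, S), f(d), F(d, S), F(d). *)
Definition max_score n (d : deck n) S : R :=
  max_of (range (fun G => expected_score d G S)).

Definition minmax_score n (d : deck n) : R :=
  min_of (range (max_score d)).

Definition min_score n (d : deck n) S : R :=
  min_of (range (fun G => expected_score d G S)).

Definition maxmin_score n (d : deck n) : R :=
  max_of (range (min_score d)).

Definition minimizing S : Prop :=
  forall n (d : deck n), (0 < n)%N -> max_score d S = minmax_score d.

Definition maximizing S : Prop :=
  forall n (d : deck n), (0 < n)%N -> min_score d S = maxmin_score d.

Definition greedy_pr n (d : deck n) (i : 'I_n) : R :=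
  if i \in supp d then #|supp d|%:R^-1 else 0.

Lemma greedy_distribution n (d : deck n) :
  d != 0 -> is_distribution (greedy_pr d).
Proof.
move=> d0; split=> [i|]; first by rewrite /greedy_pr; case: ifP => _; rewrite ?invr_ge0 ?ler0n.
rewrite /greedy_pr -big_mkcond sumr_const -[LHS]mulr_natr mulVf //.
rewrite pnatr_eq0 cards_eq0; apply: contra d0 => /eqP supp0.
apply/eqP/ffunP => i; rewrite ffunE; apply/eqP; rewrite -leqn0 leqNgt.
by have := finset.in_set0 i; rewrite -supp0 finset.inE => ->.
Qed.

Lemma greedy_supp n (d : deck n) i :
  d != 0 -> i \notin supp d -> greedy_pr d i = 0.
Proof. by rewrite /greedy_pr => _ /negPf ->. Qed.

Definition greedy : shuffler R := Shuffler greedy_distribution greedy_supp.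

Definition same_law n (d : deck n) S S' : Prop :=
  shuffle_pr S d =1 shuffle_pr S' d.

End Game.
Arguments greedy {R}.

(* Main.v *)
(** Against a Shuffler law p, a best Guesser bets on a most (least) likely card,
    so the value c + sum_i p_i v(d - delta_i), with c the largest (smallest)
    p_i, determines f (F) recursively. Let v be the value of the greedy
    strategy and k = |supp d|, so that k v(d) = 1 + sum_i v(d - delta_i).
    Then, for every law p supported in supp d,
      c + sum_i p_i v(d - delta_i) - v(d)
        = sum_(i in supp d) (c - p_i) (v(d) - v(d - delta_i)).
    An induction shows that v strictly decreases when a card is removed, so all
    terms have the same sign, and they vanish only if p is uniform.
    For F all this applies to fully-supported decks only: elsewhere the Guesser
    scores 0 by always guessing a missing card. *)
Require Import Defs.
From mathcomp Require Import all_boot all_order all_algebra.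
From mathcomp Require Import classical_sets reals.
From mathcomp Require Import ring lra.

Set Implicit Arguments.
Unset Strict Implicit.
Unset Printing Implicit Defensive.

Import Order.TTheory GRing.Theory Num.Theory.
Local Open Scope classical_set_scope.
Local Open Scope ring_scope.

(** * Supports, removal of a card, and induction on decks *)

Section DeckLemmas.
Variable n : nat.
Implicit Types (d : deck n) (i j : 'I_n).

Lemma mem_supp d i : (i \in supp d) = (0 < d i)%N.
Proof. by rewrite finset.inE. Qed.

Lemma supp_eq0 d : (supp d == finset.set0) = (d == 0).
Proof.
apply/eqP/eqP => [supp0|->].
  apply/ffunP => i; rewrite ffunE; apply/eqP; rewrite -leqn0 leqNgt.
  by rewrite -mem_supp supp0 finset.in_set0.
by apply/setP => i; rewrite mem_supp ffunE finset.in_set0.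
Qed.

Lemma supp_card_gt0 d : d != 0 -> (0 < #|supp d|)%N.
Proof. by rewrite card_gt0 supp_eq0. Qed.

Lemma deck_nonzero d i : i \in supp d -> d != 0.
Proof. by move=> di; rewrite -supp_eq0; apply/set0Pn; exists i. Qed.

Lemma exists_supp d : d != 0 -> exists i, i \in supp d.
Proof. by rewrite -supp_eq0 => /set0Pn. Qed.

Lemma deck_zero_card n0 (d : deck n0) : ~~ (0 < n0)%N -> d = 0.
Proof. by case: n0 d => // d _; apply/ffunP => -[]. Qed.

Lemma deck_card_gt0 d : d != 0 -> (0 < n)%N.
Proof. by apply: contraNT => /(@deck_zero_card n d) ->. Qed.

Lemma removeE d i j : remove d i j = (d j - (j == i))%N.
Proof. by rewrite !ffunE. Qed.

Lemma removeC d i j : remove (remove d i) j = remove (remove d j) i.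
Proof. by apply/ffunP => k; rewrite !removeE subnAC. Qed.

Lemma deck_size0 : deck_size (0 : deck n) = 0%N.
Proof. by rewrite /deck_size big1 // => i _; rewrite ffunE. Qed.

Lemma deck_size_remove d i : i \in supp d ->
  deck_size d = (deck_size (remove d i)).+1.
Proof.
rewrite mem_supp /deck_size => di.
rewrite (bigD1 i) //= [in RHS](bigD1 i) //= removeE eqxx subn1 -addSn prednK //.
by congr addn; apply: eq_bigr => j /negPf ji; rewrite removeE ji subn0.
Qed.

(** Removing a card that is present lowers [deck_size] by one. The restriction to the support
    matters: for any other [i] the truncated subtraction gives back [d] itself. *)
Lemma deck_ind (P : deck n -> Prop) :
  (forall d, (forall i, i \in supp d -> P (remove d i)) -> P d) ->
  forall d, P d.
Proof.
move=> IH d; have [m] := ubnP (deck_size d); elim: m d => // m IHm d dm.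
by apply: IH => i di; apply: IHm; rewrite (deck_size_remove di) in dm.
Qed.

Lemma supp_remove d i :
  supp (remove d i) = if d i == 1%N then supp d :\ i else supp d.
Proof.
apply/setP => j; case: ifP => [/eqP|] di; rewrite !finset.inE removeE.
  by case: eqP => [->|]; rewrite ?di ?subn0.
by case: eqP => [->|_]; rewrite ?subn0 //; case: (d i) di => [|[]].
Qed.

Lemma supp_remove_sub d i : supp (remove d i) \subset supp d.
Proof. by rewrite supp_remove; case: ifP => _; rewrite // subD1set. Qed.

Lemma fully_supported_remove d i : ~~ fully_supported d ->
  ~~ fully_supported (remove d i).
Proof.
apply: contra => /eqP full; rewrite /fully_supported finset.eqEsubset finset.subsetT.
by rewrite -full supp_remove_sub.
Qed.

Lemma fully_supported_nonzero d : (0 < n)%N -> fully_supported d -> d != 0.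
Proof.
move=> n0 /eqP full; apply: (@deck_nonzero _ (Ordinal n0)).
by rewrite full finset.in_setT.
Qed.

End DeckLemmas.

(** * Sums over plays, split at the first round *)

Lemma sum_tuple_cons (V : nmodType) (T : finType) m (F : seq T -> V) :
  \sum_(w : m.+1.-tuple T) F w = \sum_x \sum_(w : m.-tuple T) F (x :: w).
Proof.
rewrite pair_big /= (reindex (fun p : T * m.-tuple T => [tuple of p.1 :: p.2])) //=.
exists (fun w : m.+1.-tuple T => (thead w, [tuple of behead w])) => [[x w] _|w _].
  by congr pair; apply: val_inj.
by rewrite -tuple_eta.
Qed.

Lemma sum_tuple_cons_pair (V : nmodType) (A B : finType) m
    (F : seq (A * B) -> V) :
  \sum_(w : m.+1.-tuple (A * B)) F w =
  \sum_a \sum_b \sum_(w : m.-tuple (A * B)) F ((a, b) :: w).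
Proof.
rewrite sum_tuple_cons [RHS]pair_big /=.
by apply: eq_bigr => -[a b].
Qed.

Lemma exists_argmax (R : realType) n (w : 'I_n -> R) :
  (0 < n)%N -> exists i, forall j, w j <= w i.
Proof.
move=> n0; case: (@arg_maxP _ _ _ (Ordinal n0) xpredT w) => // i _ wi.
by exists i => j; apply: wi.
Qed.

(** * First-round recursion for the expected score *)

Section Values.
Variable R : realType.
Implicit Types (G : guesser R) (S : shuffler R).

(** Induction over the first round, both laws having mass 1. It is used to integrate out the later
    rounds. *)
Lemma sum_play_pr n (d : deck n) G S :
  \sum_(w : (deck_size d).-tuple ('I_n * 'I_n)) play_pr d G S w = 1.
Proof.
elim/deck_ind: d => d IH; have [->|d0] := eqVneq d 0.
  rewrite deck_size0 (big_pred1 [tuple]) // => w /=.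
  by rewrite [w]tuple0; apply/esym/eqP.
have [p0 p1] := shuffle_distribution S d0.
have [q0 q1] := guess_distribution G d0.
have [i di] := exists_supp d0.
rewrite (deck_size_remove di).
rewrite (sum_tuple_cons_pair _ (play_pr d G S)) /=.
transitivity (\sum_s shuffle_pr S d s * \sum_g guess_pr G d g); last first.
  by rewrite q1 -mulr_suml p1 mulr1.
apply: eq_bigr => s _; have [ds|ds] := boolP (s \in supp d); last first.
  rewrite (shuffle_supp S d0 ds) mul0r big1 // => g _.
  by rewrite big1 // => w _; rewrite !mul0r.
rewrite mulr_sumr; apply: eq_bigr => g _.
rewrite -mulr_sumr.
(* The tails were given the length belonging to one fixed card [i]; every card [s] of the support
   leaves the same number of rounds. *)
have : deck_size (remove d i) = deck_size (remove d s).
  by apply: succn_inj; rewrite -!deck_size_remove.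
by move=> ->; rewrite IH // mulr1.
Qed.

Lemma expected_score0 n G S : expected_score (0 : deck n) G S = 0.
Proof.
rewrite /expected_score big1 // => w _.
by case: (val w) => [|x v] /=; rewrite eqxx mulr0.
Qed.

Lemma expected_score_rec n (d : deck n) G S : d != 0 ->
  expected_score d G S =
  \sum_i shuffle_pr S d i * guess_pr G d i +
  \sum_i shuffle_pr S d i * expected_score (remove d i) G S.
Proof.
move=> d0; have [p0 p1] := shuffle_distribution S d0.
have [q0 q1] := guess_distribution G d0.
have [i di] := exists_supp d0.
rewrite /expected_score (deck_size_remove di).
rewrite (sum_tuple_cons_pair _ (fun w => play_pr d G S w * (score d w)%:R)) /=.
rewrite (negPf d0) -big_split.
apply: eq_bigr => s _ /=; have [ds|ds] := boolP (s \in supp d); last first.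
  rewrite (shuffle_supp S d0 ds) !mul0r addr0 big1 // => g _.
  by rewrite big1 // => w _; rewrite !mul0r.
have -> : deck_size (remove d i) = deck_size (remove d s).
  by apply: succn_inj; rewrite -!deck_size_remove.
set E := (X in _ = _ + _ * X).
transitivity (\sum_g (shuffle_pr S d s * guess_pr G d g * (s == g)%:R +
                      shuffle_pr S d s * guess_pr G d g * E)).
  apply: eq_bigr => g _.
  (* The first-round indicator does not depend on the tail, so it is multiplied by the total
     probability 1 of the tails. *)
  rewrite -[X in X + _]mulr1 -[X in _ * X + _](sum_play_pr (remove d s) G S) !mulr_sumr.
  rewrite -big_split; apply: eq_bigr => w _ /=; rewrite natrD; ring.
rewrite big_split /= -mulr_suml -mulr_sumr q1 mulr1; congr (_ + _).
rewrite (bigD1 s) //= eqxx mulr1 big1 ?addr0 // => g /negPf gs.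
by rewrite eq_sym gs mulr0.
Qed.

(** * Best responses of the Guesser *)

(** Point mass at one maximizer of [w n d]. Ties are broken by [pick], which depends on the deck
    alone, so this is a legitimate strategy. *)
Definition argmax_pr (w : forall n, deck n -> 'I_n -> R) n (d : deck n) i : R :=
  (Some i == [pick k | [forall j, w n d j <= w n d k]])%:R.

Lemma argmax_prP w n (d : deck n) : d != 0 ->
  exists2 k, forall j, w n d j <= w n d k &
             forall i, argmax_pr w d i = (i == k)%:R.
Proof.
move=> d0; rewrite /argmax_pr; case: pickP => [k /forallP wk|nomax].
  by exists k.
have [k wk] := exists_argmax (w n d) (deck_card_gt0 d0).
by have /forallP := nomax k.
Qed.

Lemma sum_indicator n (k : 'I_n) (p : 'I_n -> R) :
  \sum_i p i * (i == k)%:R = p k.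
Proof.
rewrite (bigD1 k) //= eqxx mulr1 big1 ?addr0 // => i /negPf ->.
exact: mulr0.
Qed.

Lemma argmax_distribution w n (d : deck n) :
  d != 0 -> is_distribution (argmax_pr w d).
Proof.
move=> /(argmax_prP w)[k _ argE]; split=> [i|]; first exact: ler0n.
rewrite -[RHS](sum_indicator k (fun=> 1)).
by apply: eq_bigr => i _; rewrite argE mul1r.
Qed.

Definition argmax_guesser w : guesser R :=
  Guesser (argmax_distribution w).

Lemma expected_score_argmax w n (d : deck n) S : d != 0 ->
  exists2 k, forall j, w n d j <= w n d k &
  expected_score d (argmax_guesser w) S = shuffle_pr S d k +
  \sum_i shuffle_pr S d i * expected_score (remove d i) (argmax_guesser w) S.
Proof.
move=> d0; have [k wk argE] := argmax_prP w d0; exists k => //.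
rewrite expected_score_rec //; congr (_ + _).
by rewrite -[RHS]sum_indicator; apply: eq_bigr => i _; rewrite /= argE.
Qed.

Lemma max_of_eq (A : set R) x : A x -> ubound A x -> max_of A = x.
Proof.
move=> Ax ubx; apply: xget_unique => // y [Ay uby].
by apply/le_anti/andP; split; [apply: ubx | apply: uby].
Qed.

Lemma min_of_eq (A : set R) x : A x -> lbound A x -> min_of A = x.
Proof.
move=> Ax lbx; apply: xget_unique => // y [Ay lby].
by apply/le_anti/andP; split; [apply: lby | apply: lbx].
Qed.

(** Guesses do not influence how the deck evolves, so optimizing each round separately is optimal:
    the chance of a hit is an average of Shuffler probabilities, at most the largest one. *)
Lemma max_scoreE n (d : deck n) S :
  max_score d S = expected_score d (argmax_guesser (shuffle_pr S)) S.
Proof.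
apply: max_of_eq; first by exists (argmax_guesser (shuffle_pr S)).
move=> _ [G _ <-]; elim/deck_ind: d => d IH.
have [->|d0] := eqVneq d 0; first by rewrite !expected_score0.
have [k pk ->] := expected_score_argmax (shuffle_pr S) S d0.
have [p0 _] := shuffle_distribution S d0.
have [q0 q1] := guess_distribution G d0.
rewrite expected_score_rec //; apply: lerD.
  rewrite -[leRHS]mulr1 -q1 mulr_sumr.
  by apply: ler_sum => i _; apply: ler_wpM2r.
apply: ler_sum => i _; have [di|/(shuffle_supp S d0) ->] := boolP (i \in supp d).
  by apply: ler_wpM2l => //; apply: IH.
by rewrite !mul0r.
Qed.

(** Negated weights turn the most likely card into the least likely one, possibly a card missing
    from the deck. *)
Lemma min_scoreE n (d : deck n) S :
  min_score d S =
  expected_score d (argmax_guesser (fun n d i => - shuffle_pr S d i)) S.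
Proof.
set w := fun n d i => _; apply: min_of_eq; first by exists (argmax_guesser w).
move=> _ [G _ <-]; elim/deck_ind: d => d IH.
have [->|d0] := eqVneq d 0; first by rewrite !expected_score0.
have [k pk ->] := expected_score_argmax w S d0.
have [p0 _] := shuffle_distribution S d0.
have [q0 q1] := guess_distribution G d0.
rewrite expected_score_rec //; apply: lerD.
  rewrite -[leLHS]mulr1 -q1 mulr_sumr.
  by apply: ler_sum => i _; apply: ler_wpM2r => //; rewrite -lerN2; apply: pk.
apply: ler_sum => i _; have [di|/(shuffle_supp S d0) ->] := boolP (i \in supp d).
  by apply: ler_wpM2l => //; apply: IH.
by rewrite !mul0r.
Qed.

Lemma max_score0 n S : max_score (0 : deck n) S = 0.
Proof. by rewrite max_scoreE expected_score0. Qed.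

Lemma min_score0 n S : min_score (0 : deck n) S = 0.
Proof. by rewrite min_scoreE expected_score0. Qed.

Lemma max_score_rec n (d : deck n) S : d != 0 ->
  exists2 k, forall j, shuffle_pr S d j <= shuffle_pr S d k &
  max_score d S = shuffle_pr S d k +
                  \sum_i shuffle_pr S d i * max_score (remove d i) S.
Proof.
move=> d0; have [k pk] := expected_score_argmax (shuffle_pr S) S d0.
rewrite -max_scoreE => ->; exists k => //.
by congr (_ + _); apply: eq_bigr => i _; rewrite max_scoreE.
Qed.

Lemma min_score_rec n (d : deck n) S : d != 0 ->
  exists2 k, forall j, shuffle_pr S d k <= shuffle_pr S d j &
  min_score d S = shuffle_pr S d k +
                  \sum_i shuffle_pr S d i * min_score (remove d i) S.
Proof.
move=> d0.
have [k pk] := expected_score_argmax (fun n d i => - shuffle_pr S d i) S d0.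
rewrite -min_scoreE => ->; exists k; first by move=> j; rewrite -lerN2; apply: pk.
by congr (_ + _); apply: eq_bigr => i _; rewrite min_scoreE.
Qed.

(** * The gap identity and its equality case *)

(** Expand the right side and use that [p] has mass 1 on [A]. Since [c] is arbitrary, the identity
    serves both the largest and the smallest probability. *)
Lemma value_gap n (A : {set 'I_n}) (p x : 'I_n -> R) c v :
  \sum_i p i = 1 -> (forall i, i \notin A -> p i = 0) ->
  #|A|%:R * v = 1 + \sum_(i in A) x i ->
  c + \sum_i p i * x i - v = \sum_(i in A) (c - p i) * (v - x i).
Proof.
move=> p1 pA vE.
have sumA y : \sum_i p i * y i = \sum_(i in A) p i * y i.
  rewrite [RHS]big_mkcond; apply: eq_bigr => i _.
  by case: ifPn => // /pA ->; rewrite mul0r.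
have {}p1 : \sum_(i in A) p i = 1.
  by have := sumA (fun=> 1); rewrite -!mulr_suml p1 !mulr1.
have -> : \sum_(i in A) (c - p i) * (v - x i) =
    (#|A|%:R * v) * c - v * (\sum_(i in A) p i) - c * (\sum_(i in A) x i)
    + \sum_(i in A) p i * x i.
  rewrite -[#|A|]sum1_card natr_sum !mulr_suml !mulr_sumr -!sumrN -!big_split.
  by apply: eq_bigr => i _ /=; ring.
by rewrite sumA vE p1; ring.
Qed.

Lemma weighted_sum_eq0 (I : finType) (A : {set I}) (e y : I -> R) :
  (forall i, i \in A -> 0 <= e i) -> (forall i, i \in A -> 0 < y i) ->
  \sum_(i in A) e i * y i = 0 -> forall i, i \in A -> e i = 0.
Proof.
move=> e0 y0 sum0 i iA; apply/eqP.
rewrite -(mulIr_eq0 _ (mulIf (lt0r_neq0 (y0 i iA)))).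
apply/eqP; apply: (psumr_eq0P _ sum0) iA => j jA.
by rewrite mulr_ge0 ?e0 // ltW ?y0.
Qed.

(** Total mass 1 forces [c] to be the inverse of [#|supp d|]. *)
Lemma constant_law_greedy S n (d : deck n) c : d != 0 ->
  (forall i, i \in supp d -> shuffle_pr S d i = c) -> same_law d S greedy.
Proof.
move=> d0 pc i; have [_ p1] := shuffle_distribution S d0.
rewrite /= /greedy_pr; case: ifPn => [di|/(shuffle_supp S d0) //].
have : #|supp d|%:R * c = 1.
  rewrite -[RHS]p1 mulr_natl -sumr_const big_mkcond /=.
  by apply: eq_bigr => j _; case: ifPn => [/pc|/(shuffle_supp S d0)].
have k0 : #|supp d|%:R != 0 :> R by rewrite pnatr_eq0 -lt0n supp_card_gt0.
by move=> kc; apply: (mulfI k0); rewrite pc // kc divff.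
Qed.

(** * Recursions for the greedy values *)

Lemma sum_greedy_pr n (d : deck n) (x : 'I_n -> R) : d != 0 ->
  #|supp d|%:R * (\sum_i greedy_pr R d i * x i) = \sum_(i in supp d) x i.
Proof.
move=> d0; rewrite mulr_sumr [RHS]big_mkcond; apply: eq_bigr => i _.
rewrite /greedy_pr; case: ifP => _; last by rewrite mul0r mulr0.
by rewrite mulrA divff ?mul1r // pnatr_eq0 -lt0n supp_card_gt0.
Qed.

Lemma max_score_greedy_rec n (d : deck n) : d != 0 ->
  #|supp d|%:R * max_score d (@greedy R) =
  1 + \sum_(i in supp d) max_score (remove d i) greedy.
Proof.
move=> d0; have [k pk ->] := max_score_rec (@greedy R) d0.
rewrite mulrDr sum_greedy_pr //; congr (_ + _).
have k0 : 0 < #|supp d|%:R :> R by rewrite ltr0n supp_card_gt0.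
(* A maximizer outside the support would have probability 0, below the positive probability of
   [i]. *)
have [i di] := exists_supp d0.
move: (pk i); rewrite /= /greedy_pr di; case: ifP => _.
  by rewrite divff ?gt_eqF.
by rewrite leNgt invr_gt0 k0.
Qed.

(** Full support makes the least greedy probability [#|supp d|%:R^-1]; a missing card would make it
    0. *)
Lemma min_score_greedy_rec n (d : deck n) : (0 < n)%N -> fully_supported d ->
  #|supp d|%:R * min_score d (@greedy R) =
  1 + \sum_(i in supp d) min_score (remove d i) greedy.
Proof.
move=> n0 full; have d0 := fully_supported_nonzero n0 full.
have [k pk ->] := min_score_rec (@greedy R) d0.
rewrite mulrDr sum_greedy_pr //; congr (_ + _).
have k0 : 0 < #|supp d|%:R :> R by rewrite ltr0n supp_card_gt0.
by rewrite /= /greedy_pr (eqP full) finset.in_setT -(eqP full) divff ?gt_eqF.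
Qed.

(** * Optimality of greedy against a maximizing Guesser *)

(** Induction comparing the recursions at [d] and at [remove d i], after scaling by [#|supp d|];
    since removals commute, corresponding terms are compared at the smaller deck [remove d j]. *)
Lemma max_score_greedy_lt n (d : deck n) i : i \in supp d ->
  max_score (remove d i) (@greedy R) < max_score d greedy.
Proof.
elim/deck_ind: d i => d IH i di; have d0 := deck_nonzero di.
have k0 : 0 < #|supp d|%:R :> R by rewrite ltr0n supp_card_gt0.
rewrite -(ltr_pM2l k0) max_score_greedy_rec //.
have IHi j : j \in supp d -> i \in supp (remove d j) ->
    max_score (remove (remove d i) j) (@greedy R) <
    max_score (remove d j) greedy.
  by move=> dj dij; rewrite removeC IH.
have := supp_remove d i; case: eqP => [di1|di1] suppE.
  (* Last copy of [i]: its term on the right cancels one of the [#|supp d|] copies of the value of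
     [remove d i] on the left. The other copies are expanded by the recursion, or vanish when no
     card remains. *)
  rewrite (cardsD1 i) di -suppE natrD mulrDl mul1r.
  rewrite (big_setD1 i) //= -suppE addrCA ltrD2l.
  have [d'0|d'0] := eqVneq (remove d i) 0.
    have /eqP -> : supp (remove d i) == finset.set0 by rewrite supp_eq0 d'0.
    by rewrite d'0 max_score0 mulr0 big_set0 addr0 ltr01.
  rewrite max_score_greedy_rec // ltrD2l; apply: ltr_sum.
    have [j d'j] := exists_supp d'0.
    by apply/hasP; exists j; rewrite ?mem_index_enum.
  move=> j; rewrite suppE finset.in_setD1 => /andP[ji dj].
  by apply: IHi => //; rewrite mem_supp removeE eq_sym (negPf ji) subn0 -mem_supp.
(* With another copy of [i] left, the supports agree and the two sums compare term by term. *)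
rewrite -suppE max_score_greedy_rec; last by rewrite -supp_eq0 suppE supp_eq0.
rewrite ltrD2l suppE; apply: ltr_sum.
  by apply/hasP; exists i; rewrite ?mem_index_enum.
move=> j dj; apply: IHi => //; move: di; rewrite !mem_supp removeE.
by case: eqP => [_|_]; rewrite ?subn0 //; case: (d i) di1 => [|[]].
Qed.

(** By induction [S] does no better than greedy in later rounds, and the gap identity bounds the
    first round. Equality makes the gap vanish, so the first-round law is constant on the
    support. *)
Lemma max_score_greedy_le S n (d : deck n) :
  max_score d greedy <= max_score d S /\
  (max_score d S = max_score d greedy -> d != 0 -> same_law d S greedy).
Proof.
elim/deck_ind: d => d IH.
have [->|d0] := eqVneq d 0; first by rewrite !max_score0.
have [k pk ->] := max_score_rec S d0.
have [p0 p1] := shuffle_distribution S d0.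
set p := shuffle_pr S d in p0 p1 pk *.
pose x i := max_score (remove d i) (@greedy R).
have le_px : \sum_i p i * x i <= \sum_i p i * max_score (remove d i) S.
  apply: ler_sum => i _; have [di|] := boolP (i \in supp d).
    by rewrite ler_wpM2l //; apply: (IH i di).1.
  by rewrite /p => /(shuffle_supp S d0) ->; rewrite !mul0r.
have xd i : i \in supp d -> 0 < max_score d greedy - x i.
  by move=> di; rewrite subr_gt0 max_score_greedy_lt.
have pk0 i : i \in supp d -> 0 <= p k - p i by rewrite subr_ge0.
have gap := value_gap (p k) p1 (fun i => @shuffle_supp _ S _ d i d0)
              (max_score_greedy_rec d0).
have gap_ge0 : 0 <= p k + \sum_i p i * x i - max_score d greedy.
  rewrite gap; apply: sumr_ge0 => i di.
  by rewrite mulr_ge0 ?pk0 // ltW ?xd.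
split=> [|eq_v _]; first by move: gap_ge0 le_px; lra.
have /(weighted_sum_eq0 pk0 xd) pkE :
    \sum_(i in supp d) (p k - p i) * (max_score d greedy - x i) = 0.
  by rewrite -gap; move: gap_ge0 le_px eq_v; lra.
apply: (constant_law_greedy (c := p k) d0) => i di.
by apply/eqP; rewrite eq_sym -subr_eq0 pkE.
Qed.

(** * Optimality of greedy against a minimizing Guesser *)

(** A missing card has probability 0, which is then the least one, and it stays missing after every
    removal. *)
Lemma min_score_not_full S n (d : deck n) :
  ~~ fully_supported d -> min_score d S = 0.
Proof.
elim/deck_ind: d => d IH nfull.
have [->|d0] := eqVneq d 0; first by rewrite min_score0.
have [k pk ->] := min_score_rec S d0; have [p0 _] := shuffle_distribution S d0.
have [i di] : exists i, i \notin supp d.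
  apply/existsP; apply: contraNT nfull; rewrite negb_exists => /forallP full.
  by apply/eqP/setP => i; rewrite finset.in_setT; apply/negPn/full.
have -> : shuffle_pr S d k = 0.
  by apply/le_anti; rewrite p0 -(shuffle_supp S d0 di) pk.
rewrite add0r big1 // => j _; have [dj|/(shuffle_supp S d0) ->] := boolP (j \in supp d).
  by rewrite IH ?mulr0 ?fully_supported_remove.
exact: mul0r.
Qed.

Lemma min_score_greedy_ge0 n (d : deck n) : 0 <= min_score d (@greedy R).
Proof.
elim/deck_ind: d => d IH; have [->|d0] := eqVneq d 0; first by rewrite min_score0.
have [full|/min_score_not_full -> //] := boolP (fully_supported d).
have k0 : 0 < #|supp d|%:R :> R by rewrite ltr0n supp_card_gt0.
rewrite -(pmulr_rge0 _ k0) min_score_greedy_rec ?(deck_card_gt0 d0) //.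
by rewrite addr_ge0 // sumr_ge0.
Qed.

Lemma min_score_greedy_lt n (d : deck n) i : (0 < n)%N -> fully_supported d ->
  min_score (remove d i) (@greedy R) < min_score d greedy.
Proof.
move=> n0; elim/deck_ind: d i => d IH i full.
have suppT j : j \in supp d by rewrite (eqP full) finset.in_setT.
have d0 := deck_nonzero (suppT i).
have k0 : 0 < #|supp d|%:R :> R by rewrite ltr0n supp_card_gt0.
rewrite -(ltr_pM2l k0) min_score_greedy_rec //.
have [full'|/min_score_not_full ->] := boolP (fully_supported (remove d i)).
  have suppE : supp (remove d i) = supp d by rewrite (eqP full) (eqP full').
  rewrite -suppE min_score_greedy_rec // suppE ltrD2l.
  (* Strictness comes from the term of [i], as [remove d i] is fully supported. For other [j] the
     deck [remove d j] may lack a type, and then both values are 0. *)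
  rewrite (big_setD1 i) //= [ltRHS](big_setD1 i) //=.
  apply: ltr_leD; first exact: IH.
  apply: ler_sum => j _; rewrite removeC.
  have [fullj|nfullj] := boolP (fully_supported (remove d j)).
    by rewrite ltW ?IH.
  by rewrite !min_score_not_full // fully_supported_remove.
(* The smaller deck lacks a type and has value 0, while the right side is 1 plus nonnegative
   terms. *)
rewrite mulr0 ltr_pwDl // sumr_ge0 // => j _; exact: min_score_greedy_ge0.
Qed.

(** The argument for the maximizing Guesser with signs reversed: [p k] is now the least probability.
    Decks lacking a type have value 0 for both strategies. *)
Lemma min_score_greedy_ge S n (d : deck n) :
  min_score d S <= min_score d greedy /\
  (min_score d S = min_score d greedy -> (0 < n)%N -> fully_supported d ->
   same_law d S greedy).
Proof.
elim/deck_ind: d => d IH.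
have [full|nfull] := boolP (fully_supported d); last first.
  by rewrite !min_score_not_full.
(* For [n = 0] the zero deck is vacuously fully supported. *)
have [n0|/(deck_zero_card d) ->] := boolP (0 < n)%N; last by rewrite !min_score0.
have d0 := fully_supported_nonzero n0 full.
have [k pk ->] := min_score_rec S d0.
have [p0 p1] := shuffle_distribution S d0.
set p := shuffle_pr S d in p0 p1 pk *.
pose x i := min_score (remove d i) (@greedy R).
have le_px : \sum_i p i * min_score (remove d i) S <= \sum_i p i * x i.
  apply: ler_sum => i _; have [di|] := boolP (i \in supp d).
    by rewrite ler_wpM2l //; apply: (IH i di).1.
  by rewrite /p => /(shuffle_supp S d0) ->; rewrite !mul0r.
have xd i : i \in supp d -> 0 < min_score d greedy - x i.
  by move=> di; rewrite subr_gt0 min_score_greedy_lt.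
have pk0 i : i \in supp d -> 0 <= p i - p k by rewrite subr_ge0.
have gap : min_score d greedy - (p k + \sum_i p i * x i) =
    \sum_(i in supp d) (p i - p k) * (min_score d greedy - x i).
  rewrite -opprB (value_gap (p k) p1 (fun i => @shuffle_supp _ S _ d i d0)
              (min_score_greedy_rec n0 full)) -sumrN.
  by apply: eq_bigr => i _; rewrite -mulNr opprB.
have gap_ge0 : 0 <= min_score d greedy - (p k + \sum_i p i * x i).
  rewrite gap; apply: sumr_ge0 => i di.
  by rewrite mulr_ge0 ?pk0 // ltW ?xd.
split=> [|eq_v _ _]; first by move: gap_ge0 le_px; lra.
have /(weighted_sum_eq0 pk0 xd) pkE :
    \sum_(i in supp d) (p i - p k) * (min_score d greedy - x i) = 0.
  by rewrite -gap; move: gap_ge0 le_px eq_v; lra.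
apply: (constant_law_greedy (c := p k) d0) => i di.
by apply/eqP; rewrite -subr_eq0 pkE.
Qed.

(** * Values of the game and the converse implications *)

Lemma minmax_score_greedy n (d : deck n) :
  minmax_score R d = max_score d greedy.
Proof.
apply: min_of_eq; first by exists greedy.
by move=> _ [S _ <-]; apply: (max_score_greedy_le S d).1.
Qed.

Lemma maxmin_score_greedy n (d : deck n) :
  maxmin_score R d = min_score d greedy.
Proof.
apply: max_of_eq; first by exists greedy.
by move=> _ [S _ <-]; apply: (min_score_greedy_ge S d).1.
Qed.

Lemma max_score_same_law S S' n :
  (forall d : deck n, d != 0 -> same_law d S S') ->
  forall d : deck n, max_score d S = max_score d S'.
Proof.
move=> eqS; elim/deck_ind => d IH.
have [->|d0] := eqVneq d 0; first by rewrite !max_score0.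
have [k pk ->] := max_score_rec S d0; have [k' pk' ->] := max_score_rec S' d0.
congr (_ + _).
  (* The maximizers [k] and [k'] may differ, but each probability bounds the other because the laws
     agree. *)
  by apply/le_anti; rewrite [X in _ && (X <= _)](esym (eqS d d0 k')) pk eqS // pk'.
apply: eq_bigr => i _; have [di|di] := boolP (i \in supp d).
  by rewrite eqS // IH.
by rewrite !(shuffle_supp _ d0 di) !mul0r.
Qed.

(** A deck lacking a type has value 0 for every Shuffler, so agreement on fully-supported decks
    carries the induction. *)
Lemma min_score_same_law S S' n :
  (forall d : deck n, fully_supported d -> same_law d S S') ->
  forall d : deck n, min_score d S = min_score d S'.
Proof.
move=> eqS; elim/deck_ind => d IH.
have [full|nfull] := boolP (fully_supported d); last first.
  by rewrite !min_score_not_full.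
have [->|d0] := eqVneq d 0; first by rewrite !min_score0.
have [k pk ->] := min_score_rec S d0; have [k' pk' ->] := min_score_rec S' d0.
congr (_ + _).
  by apply/le_anti; rewrite -[X in _ <= X](eqS d full) pk eqS // pk'.
apply: eq_bigr => i _; have [di|di] := boolP (i \in supp d).
  by rewrite eqS // IH.
by rewrite !(shuffle_supp _ d0 di) !mul0r.
Qed.

End Values.

Theorem theorem2p5 (R : realType) (S : shuffler R) :
  (minimizing S <->
     forall (n : nat) (d : deck n), (0 < n)%N -> d != 0 -> same_law d S greedy)
  /\
  (maximizing S <->
     forall (n : nat) (d : deck n), (0 < n)%N -> fully_supported d ->
       same_law d S greedy).
Proof.
split; split=> optS n d n0.
- apply: (max_score_greedy_le S d).2.
  by rewrite -minmax_score_greedy; apply: optS.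
- rewrite minmax_score_greedy; apply: max_score_same_law => d'.
  exact: optS.
- move=> full; apply: (min_score_greedy_ge S d).2 => //.
  by rewrite -maxmin_score_greedy; apply: optS.
- rewrite maxmin_score_greedy; apply: min_score_same_law => d'.
  exact: optS.
Qed.
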